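(* Let $\alpha,\beta\in\mathbb{R}$ and $\eta\in\{1,-1\}$, and let $(G_4,g,J)$ be the connected, simply connected three-dimensional Lorentzian Lie group with product structure $J$ whose Lie algebra $\mathfrak{g}$ has a pseudo-orthonormal basis $\{e_1,e_2,e_3\}$ ($e_3$ timelike) with $[e_1,e_2]=-e_2+(2\eta-\beta)e_3$, $[e_1,e_3]=-\beta e_2+e_3$, $[e_2,e_3]=\alpha e_1$. Let $c\in\mathbb{R}$. Then $(G_4,g,J)$ is a second kind algebraic Ricci soliton associated to the canonical connection $\nabla^0$ with constant $c$ if and only if $\alpha=0$, $\beta=\eta$, $c=0$. In particular, in that case $D=0$.
   Context: The left-invariant Lorentzian metric $g$ satisfies $g(e_1,e_1)=g(e_2,e_2)=1$, $g(e_3,e_3)=-1$, $g(e_i,e_j)=0$ for $i\ne j$. All tensors and connections are left-invariant and evaluated on $\mathfrak{g}$. $\nabla$ is the Levi-Civita connection of $g$. The product structure is $Je_1=e_1$, $Je_2=e_2$, $Je_3=-e_3$, and $(\nabla_XJ)Y=\nabla_X(JY)-J(\nabla_XY)$. The canonical connection is $\nabla^0_XY=\nabla_XY-\frac12(\nabla_XJ)(JY)$, with curvature $R^0(X,Y)Z=\nabla^0_X\nabla^0_YZ-\nabla^0_Y\nabla^0_XZ-\nabla^0_{[X,Y]}Z$. Its Ricci tensor is $\rho^0(X,Y)=-g(R^0(X,e_1)Y,e_1)-g(R^0(X,e_2)Y,e_2)+g(R^0(X,e_3)Y,e_3)$; its symmetrization is $\widetilde\rho^0(X,Y)=\frac12(\rho^0(X,Y)+\rho^0(Y,X))$,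 and the operator $\widetilde{\mathrm{Ric}}^0$ is defined by $\widetilde\rho^0(X,Y)=g(\widetilde{\mathrm{Ric}}^0(X),Y)$. Second kind algebraic Ricci soliton associated to $\nabla^0$ with constant $c$ means: $\widetilde{\mathrm{Ric}}^0=c\,\mathrm{Id}+D$ where $D$ is a derivation of $\mathfrak{g}$, i.e. a linear map with $D[X,Y]=[DX,Y]+[X,DY]$ for all $X,Y\in\mathfrak{g}$. *)

(* Defs.v *)
From HB Require Import structures.
From mathcomp Require Import all_boot all_order all_algebra.
From mathcomp Require Import ring lra.
From mathcomp Require Export reals.

Set Implicit Arguments.
Unset Strict Implicit.
Unset Printing Implicit Defensive.

Import Order.TTheory GRing.Theory Num.Theory.

Local Open Scope ring_scope.

(* A left-invariant tensor or connection on a Lie group is determined by its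
   value on left-invariant vector fields, so everything below lives on the
   Lie algebra V, a finite-dimensional real vector space with bracket br.  In
   particular X (g(Y, Z)) = 0 for left-invariant X, Y, Z, which is why no
   directional derivative appears in [levi_civita]. *)

Section LieAlgebra.
Variables (R : realType) (V : vectType R) (br : {bilinear V -> V -> V}).

Definition lie_bracket : Prop :=
  (forall X, br X X = 0) /\
  (forall X Y Z, br X (br Y Z) + br Y (br Z X) + br Z (br X Y) = 0).

Definition derivation (D : 'End(V)) : Prop :=
  forall X Y, D (br X Y) = br (D X) Y + br X (D Y).

Definition curvature (conn : V -> V -> V) (X Y Z : V) : V :=
  conn X (conn Y Z) - conn Y (conn X Z) - conn (br X Y) Z.

End LieAlgebra.

Section LorentzianMetric.
Variables (R : realType) (V : vectType R).

Definition pseudo_orthonormal_basis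
    (g : {bilinear V -> V -> R | *%R & *%R}) (e1 e2 e3 : V) : Prop :=
  [/\ basis_of fullv [:: e1; e2; e3],
      forall X Y, g X Y = g Y X,
      [/\ g e1 e1 = 1, g e2 e2 = 1 & g e3 e3 = -1] &
      [/\ g e1 e2 = 0, g e1 e3 = 0 & g e2 e3 = 0]].

Definition levi_civita (br : {bilinear V -> V -> V})
    (g : {bilinear V -> V -> R | *%R & *%R})
    (nabla : {bilinear V -> V -> V}) : Prop :=
  (forall X Y, nabla X Y - nabla Y X = br X Y) /\
  (forall X Y Z, g (nabla X Y) Z + g Y (nabla X Z) = 0).

End LorentzianMetric.

Section CanonicalConnection.
Variables (R : realType) (V : vectType R).
Implicit Types X Y Z : V.

Definition covariant_derivative (nabla : V -> V -> V) (J : 'End(V)) X Y : V :=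
  nabla X (J Y) - J (nabla X Y).

Definition canonical_connection (nabla : V -> V -> V) (J : 'End(V)) X Y : V :=
  nabla X Y - 2^-1 *: covariant_derivative nabla J X (J Y).

Definition ricci (br : {bilinear V -> V -> V})
    (g : {bilinear V -> V -> R | *%R & *%R}) (e1 e2 e3 : V)
    (conn : V -> V -> V) X Y : R :=
  - g (curvature br conn X e1 Y) e1
  - g (curvature br conn X e2 Y) e2
  + g (curvature br conn X e3 Y) e3.

Definition symmetrized (rho : V -> V -> R) X Y : R :=
  2^-1 * (rho X Y + rho Y X).

Definition operator_of_form (g : {bilinear V -> V -> R | *%R & *%R})
    (rho : V -> V -> R) (Ric : 'End(V)) : Prop :=
  forall X Y, rho X Y = g (Ric X) Y.

(* Applied to the operator of the symmetrized Ricci tensor of the canonical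
   connection, this is the second kind algebraic Ricci soliton equation. *)
Definition soliton_with (br : {bilinear V -> V -> V}) (Ric : 'End(V))
    (c : R) (D : 'End(V)) : Prop :=
  derivation br D /\ Ric = c *: \1%VF + D.

Definition algebraic_ricci_soliton (br : {bilinear V -> V -> V})
    (Ric : 'End(V)) (c : R) : Prop :=
  exists D : 'End(V), soliton_with br Ric c D.

End CanonicalConnection.

(* [levi_civita] and [operator_of_form] are predicates; for a pseudo-orthonormal
   basis each of them has exactly one solution. *)

Section Determined.
Variables (R : realType) (V : vectType R).
Variables (g : {bilinear V -> V -> R | *%R & *%R}) (e1 e2 e3 : V).
Hypothesis he : pseudo_orthonormal_basis g e1 e2 e3.

Lemma basis_expand X : X = g X e1 *: e1 + g X e2 *: e2 - g X e3 *: e3.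
Proof.
have [hb hs [h11 h22 h33] [h12 h13 h23]] := he.
have : X \in <<in_tuple [:: e1; e2; e3]>>%VS by rewrite (span_basis hb) memvf.
move=> /coord_span; rewrite !big_ord_recl big_ord0 addr0 /=.
move: (coord _ _ X) (coord _ _ X) (coord _ _ X) => a b c ->.
rewrite !(linearDl, linearZl_LR) /= !(hs e2 e1, hs e3 e1, hs e3 e2).
by rewrite h11 h22 h33 h12 h13 h23 !(mulr0, mulr1, addr0, add0r) mulrN1 scaleNr opprK addrA.
Qed.

Lemma metric_nondegenerate X Y : (forall Z, g X Z = g Y Z) -> X = Y.
Proof. by move=> h; rewrite (basis_expand X) (basis_expand Y) !h. Qed.

Variable br : {bilinear V -> V -> V}.
Hypothesis hbr : lie_bracket br.

Let brN X Y : br Y X = - br X Y.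
Proof.
have [h _] := hbr; apply/eqP; rewrite -addr_eq0 addrC; apply/eqP.
by move: (h (X + Y)); rewrite linearDl /= !linearDr !h addr0 add0r.
Qed.

Let koszul_coef X Y Z : R :=
  2^-1 * (g (br X Y) Z - g (br Y Z) X + g (br Z X) Y).

Let koszul X Y : V :=
  koszul_coef X Y e1 *: e1 + koszul_coef X Y e2 *: e2
  - koszul_coef X Y e3 *: e3.

Let koszul_coefl a X X' Y Z :
  koszul_coef (a *: X + X') Y Z = a * koszul_coef X Y Z + koszul_coef X' Y Z.
Proof. by rewrite /koszul_coef !(linearPl, linearPr) /=; ring. Qed.

Let koszul_coefm a X Y Y' Z :
  koszul_coef X (a *: Y + Y') Z = a * koszul_coef X Y Z + koszul_coef X Y' Z.
Proof. by rewrite /koszul_coef !(linearPl, linearPr) /=; ring. Qed.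

Let koszul_coefr a X Y Z Z' :
  koszul_coef X Y (a *: Z + Z') = a * koszul_coef X Y Z + koszul_coef X Y Z'.
Proof. by rewrite /koszul_coef !(linearPl, linearPr) /=; ring. Qed.

Let expand_linear (f : V -> R) :
    (forall a X Y, f (a *: X + Y) = a * f X + f Y) ->
  forall Z, g (f e1 *: e1 + f e2 *: e2 - f e3 *: e3) Z = f Z.
Proof.
move=> hf Z; have f0 : f 0 = 0.
  by move: (hf (-1) 0 0); rewrite scaler0 addr0 mulN1r addNr.
have hs : forall X Y, g X Y = g Y X by case: he.
have -> : f Z = g Z e1 * f e1 + g Z e2 * f e2 - g Z e3 * f e3.
  rewrite [in LHS](basis_expand Z) -addrA hf hf -scaleNr -[_ *: e3]addr0 hf f0.
  by rewrite mulNr addr0 addrA.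
by rewrite !(linearDl, linearNl, linearZl_LR) /= !(hs _ Z); ring.
Qed.

Let koszulE X Y Z : g (koszul X Y) Z = koszul_coef X Y Z.
Proof. by apply: expand_linear => *; exact: koszul_coefr. Qed.

Let koszul_bilinear : bilinear_for *:%R *:%R koszul.
Proof.
split=> [Y a X X' | X a Y Y']; apply: metric_nondegenerate => Z;
  by rewrite linearPl /= !koszulE ?koszul_coefl ?koszul_coefm.
Qed.

Lemma levi_civita_exists : exists nabla, levi_civita br g nabla.
Proof.
have hs : forall X Y, g X Y = g Y X by case: he.
pose nabla : {bilinear V -> V -> V} := HB.pack koszul
  (bilinear_isBilinear.Build R V V V *:%R *:%R koszul koszul_bilinear).
exists nabla; split=> [X Y | X Y Z] /=.
  apply: metric_nondegenerate => Z.
  rewrite linearBl /= !koszulE /koszul_coef (brN X Y) (brN Y Z) (brN X Z).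
  by rewrite !linearNl /=; field.
rewrite (hs Y) !koszulE /koszul_coef (brN X Y) (brN Z Y) (brN X Z).
by rewrite !linearNl /=; field.
Qed.

Lemma levi_civita_unique (nabla nabla' : {bilinear V -> V -> V}) :
  levi_civita br g nabla -> levi_civita br g nabla' ->
  forall X Y, nabla X Y = nabla' X Y.
Proof.
have hs : forall X Y, g X Y = g Y X by case: he.
have koszul_formula (n : {bilinear V -> V -> V}) : levi_civita br g n ->
    forall X Y, n X Y = koszul X Y.
  move=> [ht hm] X Y; apply: metric_nondegenerate => Z.
  rewrite koszulE /koszul_coef -!ht !linearBl /=.
  move: (hm X Y Z) (hm Y X Z) (hm Z X Y).
  rewrite (hs Y) (hs X (n Y Z)) (hs X (n Z Y)) => h1 h2 h3.
  lra.
by move=> /koszul_formula h /koszul_formula h' X Y; rewrite h h'.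
Qed.

Lemma operator_of_form_unique (rho : V -> V -> R) (Ric Ric' : 'End(V)) :
  operator_of_form g rho Ric -> operator_of_form g rho Ric' -> Ric = Ric'.
Proof.
move=> h h'; apply/lfunP => X; apply: metric_nondegenerate => Y.
by rewrite -h -h'.
Qed.

Let operator_exists (rho : V -> V -> R) :
    (forall a X X' Y, rho (a *: X + X') Y = a * rho X Y + rho X' Y) ->
    (forall a X Y Y', rho X (a *: Y + Y') = a * rho X Y + rho X Y') ->
  exists Ric, operator_of_form g rho Ric.
Proof.
move=> hl hr.
pose f X : V := rho X e1 *: e1 + rho X e2 *: e2 - rho X e3 *: e3.
have fE X Y : g (f X) Y = rho X Y by apply: expand_linear => *; exact: hr.
have flin : linear f.
  move=> a X X'; apply: metric_nondegenerate => Y.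
  by rewrite linearPl /= !fE hl.
pose F : {linear V -> V} := HB.pack f (GRing.isLinear.Build R V V *:%R f flin).
by exists (linfun F) => X Y; rewrite lfunE /= fE.
Qed.

Lemma ricci_operator_exists (nabla : {bilinear V -> V -> V}) (J : 'End(V)) :
  exists Ric, operator_of_form g
    (symmetrized (ricci br g e1 e2 e3 (canonical_connection nabla J))) Ric.
Proof.
set n0 := canonical_connection nabla J.
have n0l a X X' Y : n0 (a *: X + X') Y = a *: n0 X Y + n0 X' Y.
  apply: metric_nondegenerate => Z.
  rewrite /n0 /canonical_connection /covariant_derivative.
  by rewrite !(linearPl, linearPr, linearP, linearBl, linearZl_LR) /=; ring.
have n0r a X Y Y' : n0 X (a *: Y + Y') = a *: n0 X Y + n0 X Y'.
  apply: metric_nondegenerate => Z.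
  rewrite /n0 /canonical_connection /covariant_derivative.
  by rewrite !(linearPl, linearPr, linearP, linearBl, linearZl_LR) /=; ring.
have curvl a X X' Z Y W : g (curvature br n0 (a *: X + X') Z Y) W =
    a * g (curvature br n0 X Z Y) W + g (curvature br n0 X' Z Y) W.
  by rewrite /curvature linearPl /= !(n0l, n0r) !(linearPl, linearBl) /=; ring.
have curvr a X Z Y Y' W : g (curvature br n0 X Z (a *: Y + Y')) W =
    a * g (curvature br n0 X Z Y) W + g (curvature br n0 X Z Y') W.
  by rewrite /curvature /= !(n0l, n0r) !(linearPl, linearBl) /=; ring.
apply: operator_exists => *; rewrite /symmetrized /ricci !curvl !curvr; ring.
Qed.

End Determined.

(* Main.v *)
(** Since J = 1 on span(e1, e2) and J = -1 on e3, the canonical connection is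
    nabla^0_X Y = (nabla_X Y + J nabla_X J Y) / 2, the part of the Levi-Civita
    connection that preserves the splitting.  It is therefore governed by the
    single 1-form w X = g(nabla_X e1, e2): nabla^0_X e1 = w(X) e2,
    nabla^0_X e2 = - w(X) e1, nabla^0_X e3 = 0.  The rotations it takes values
    in commute, so its curvature is - w([X, Y]) times the rotation generator,
    and Ric has matrix entries in p = (2 eta - beta) w(e3) - 1 and
    q = (w(e3) - beta) / 2.  The derivation property of Ric - c Id then becomes
    a polynomial system in alpha, beta, eta, c. *)
Require Import Defs.
From mathcomp Require Import all_boot all_order all_algebra.
From mathcomp Require Import reals ring lra.

Set Implicit Arguments.
Unset Strict Implicit.
Unset Printing Implicit Defensive.

Import Order.TTheory GRing.Theory Num.Theory.

Local Open Scope ring_scope.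

Lemma lie_bracketN (R : realType) (V : vectType R) (br : {bilinear V -> V -> V})
  (hbr : lie_bracket br) X Y : br Y X = - br X Y.
Proof.
have [h _] := hbr; apply/eqP; rewrite -addr_eq0 addrC; apply/eqP.
by move: (h (X + Y)); rewrite linearDl /= !linearDr !h addr0 add0r.
Qed.

(** Torsion-freeness turns each bracket into a difference of [nabla] terms; metric compatibility
    along each of X, Y and Z then cancels everything except two copies of one term. *)
Lemma koszul_formula (R : realType) (V : vectType R)
  (br : {bilinear V -> V -> V}) (g : {bilinear V -> V -> R | *%R & *%R})
  (hs : forall X Y, g X Y = g Y X) (nabla : {bilinear V -> V -> V})
  (hnabla : levi_civita br g nabla) X Y Z :
  2 * g (nabla X Y) Z = g (br X Y) Z - g (br Y Z) X + g (br Z X) Y.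
Proof.
have [ht hm] := hnabla; rewrite -!ht !linearBl /=.
move: (hm X Y Z) (hm Y X Z) (hm Z X Y).
rewrite (hs Y) (hs X (nabla Y Z)) (hs X (nabla Z Y)) => h1 h2 h3.
lra.
Qed.

Section ProductStructure.
Variables (R : realType) (V : vectType R) (br : {bilinear V -> V -> V}).
Variables (g : {bilinear V -> V -> R | *%R & *%R}) (e1 e2 e3 : V).
Hypothesis he : pseudo_orthonormal_basis g e1 e2 e3.
Variable J : 'End(V).
Hypotheses (hJ1 : J e1 = e1) (hJ2 : J e2 = e2) (hJ3 : J e3 = - e3).
Variable nabla : {bilinear V -> V -> V}.
Hypothesis hnabla : levi_civita br g nabla.

Let n0 := canonical_connection nabla J.
Let w X := g (nabla X e1) e2.

Let hs X Y : g X Y = g Y X. Proof. by case: he. Qed.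

Lemma metric_frame a b d :
  [/\ g (a *: e1 + b *: e2 + d *: e3) e1 = a,
      g (a *: e1 + b *: e2 + d *: e3) e2 = b &
      g (a *: e1 + b *: e2 + d *: e3) e3 = - d].
Proof.
have [_ _ [h11 h22 h33] [h12 h13 h23]] := he.
rewrite !(linearDl, linearZl_LR) /= !(hs e2 e1, hs e3 e1, hs e3 e2).
by rewrite h11 h22 h33 h12 h13 h23; split; ring.
Qed.

Lemma frame_inj a b d a' b' d' :
  a *: e1 + b *: e2 + d *: e3 = a' *: e1 + b' *: e2 + d' *: e3 ->
  [/\ a = a', b = b' & d = d'].
Proof.
move=> h; have [h1 h2 h3] := metric_frame a b d.
have := metric_frame a' b' d'; rewrite -h h1 h2 h3 => -[-> -> h3'].
by split=> //; apply: oppr_inj.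
Qed.

Lemma product_structure_frame a b d :
  J (a *: e1 + b *: e2 + d *: e3) = a *: e1 + b *: e2 + - d *: e3.
Proof. by rewrite !linearD !linearZ /= hJ1 hJ2 hJ3 scalerN scaleNr. Qed.

Lemma product_structureK X : J (J X) = X.
Proof.
by rewrite (basis_expand he X) -scaleNr !product_structure_frame opprK.
Qed.

Lemma canonical_connectionE X Y :
  n0 X Y = 2^-1 *: (nabla X Y + J (nabla X (J Y))).
Proof.
rewrite /n0 /canonical_connection /covariant_derivative product_structureK.
rewrite scalerBr scalerDr opprB addrA addrAC -[X in X - _]scale1r.
by rewrite -scalerBl; congr (_ *: _ + _); field.
Qed.

Lemma canonical_connectionZ a X Y : n0 X (a *: Y) = a *: n0 X Y.
Proof.
rewrite !canonical_connectionE !linearZ /=.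
by rewrite -!scalerDr !scalerA mulrC.
Qed.

Lemma canonical_connection0 X : n0 X 0 = 0.
Proof. by rewrite -[in LHS](scale0r 0) canonical_connectionZ scale0r. Qed.

(** Metric compatibility removes the e1-component of [nabla X e1]; averaging with its image under
    [J] removes the e3-component and keeps the e2-component. *)
Lemma canonical_connection_e1 X : n0 X e1 = w X *: e2.
Proof.
have [_ hm] := hnabla.
rewrite canonical_connectionE hJ1 (basis_expand he (nabla X e1)).
have -> : g (nabla X e1) e1 = 0 by move: (hm X e1 e1); rewrite (hs e1); lra.
rewrite scale0r add0r linearB !linearZ /= hJ2 hJ3 /w scalerN opprK.
rewrite addrACA addNr addr0 -mulr2n -scaler_nat scalerA.
by rewrite mulVf ?scale1r ?pnatr_eq0.
Qed.

Lemma canonical_connection_e2 X : n0 X e2 = - w X *: e1.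
Proof.
have [_ hm] := hnabla.
rewrite canonical_connectionE hJ2 (basis_expand he (nabla X e2)).
have -> : g (nabla X e2) e2 = 0 by move: (hm X e2 e2); rewrite (hs e2); lra.
have -> : g (nabla X e2) e1 = - w X.
  by move: (hm X e2 e1); rewrite (hs e2) /w; lra.
rewrite scale0r addr0 linearB !linearZ /= hJ1 hJ3 scalerN opprK.
rewrite addrACA addNr addr0 -mulr2n -scaler_nat scalerA.
by rewrite mulVf ?scale1r ?pnatr_eq0.
Qed.

Lemma canonical_connection_e3 X : n0 X e3 = 0.
Proof.
have [_ hm] := hnabla.
rewrite canonical_connectionE hJ3 (linearNr nabla) /=.
rewrite (basis_expand he (nabla X e3)).
have -> : g (nabla X e3) e3 = 0 by move: (hm X e3 e3); rewrite (hs e3); lra.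
rewrite -[- (0 *: _)]scaleNr -scaleN1r linearZ /= product_structure_frame.
by rewrite scaleN1r !oppr0 subrr scaler0.
Qed.

(** Second derivatives of e1 give -w(X) w(Y) e1, which is symmetric in X and Y. So only -w([X, ei])
    e2 survives in the curvature, and the trace retains i = 2. *)
Lemma ricci_e1 X : ricci br g e1 e2 e3 n0 X e1 = w (br X e2).
Proof.
have [_ _ [h11 h22 h33] [h12 h13 h23]] := he.
rewrite /ricci /curvature !canonical_connection_e1 !canonical_connectionZ.
rewrite !canonical_connection_e2 !(linearBl, linearZl_LR) /=.
by rewrite !(hs e2 e1) h11 h22 h12 h13 h23; ring.
Qed.

Lemma ricci_e2 X : ricci br g e1 e2 e3 n0 X e2 = - w (br X e1).
Proof.
have [_ _ [h11 h22 h33] [h12 h13 h23]] := he.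
rewrite /ricci /curvature !canonical_connection_e2 !canonical_connectionZ.
rewrite !canonical_connection_e1 !(linearBl, linearZl_LR) /=.
by rewrite !(hs e2 e1) h11 h22 h12 h13 h23; ring.
Qed.

Lemma ricci_e3 X : ricci br g e1 e2 e3 n0 X e3 = 0.
Proof.
rewrite /ricci /curvature !canonical_connection_e3 !canonical_connection0.
by rewrite !subr0 !(linear0l g) /= subr0 addr0 oppr0.
Qed.

End ProductStructure.

(* With D = Ric - c Id, the equations are the components of
   D [ei, ej] = [D ei, ej] + [ei, D ej] along e1 for (e2, e3), along e2 and e3
   for (e1, e2), and along e2 for (e1, e3); the other components are trivial or
   repeat the second one. *)
Lemma soliton_system (R : realType) (alpha beta eta c : R)
    (p := (2 * eta - beta) * (eta + alpha / 2) - 1)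
    (q := (eta + alpha / 2 - beta) / 2) :
    eta = 1 \/ eta = -1 ->
    alpha * c = 0 -> p - c = 2 * q * (beta - eta) ->
    2 * q = (2 * eta - beta) * (2 * p - c) -> 2 * q = c * beta ->
  [/\ alpha = 0, beta = eta & c = 0].
Proof.
move=> heta hac hp hq hqc; rewrite /p /q in hp hq hqc.
have c0 : c = 0.
  have /orP[/eqP a0 | /eqP //] : (alpha == 0) || (c == 0).
    by rewrite -mulf_eq0 hac.
  rewrite a0 in hp hq hqc.
  have hc : c = eta * (eta - beta) + (eta - beta) ^+ 2.
    by case: heta hp => ->; lra.
  (* Put u = eta - beta. As eta^2 = 1, here p = eta u, 2q = u and c = eta u + u^2, so [hq] collapses
     to u = u - u^3. *)
  have u0 : (eta - beta) ^+ 3 = 0.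
    by rewrite hc in hq; case: heta hq => ->; lra.
  move/eqP: u0; rewrite expf_eq0 /= => /eqP u0.
  by rewrite hc u0; ring.
have w_beta : eta + alpha / 2 = beta by rewrite c0 in hqc; lra.
rewrite c0 w_beta in hp.
(* Now q = 0, and eta^2 = 1 makes p equal to -(beta - eta)^2. *)
have : (beta - eta) ^+ 2 = 0 by case: heta hp => ->; lra.
move/eqP; rewrite expf_eq0 /= subr_eq0 => /eqP beta_eta.
by split=> //; lra.
Qed.

Theorem theorem2p35 (R : realType) (alpha beta eta : R)
  (heta : eta = 1 \/ eta = -1)
  (V : vectType R) (br : {bilinear V -> V -> V}) (hbr : lie_bracket br)
  (g : {bilinear V -> V -> R | *%R & *%R}) (e1 e2 e3 : V)
  (he : pseudo_orthonormal_basis g e1 e2 e3)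
  (h12 : br e1 e2 = - e2 + (2 * eta - beta) *: e3)
  (h13 : br e1 e3 = - beta *: e2 + e3)
  (h23 : br e2 e3 = alpha *: e1)
  (J : 'End(V)) (hJ1 : J e1 = e1) (hJ2 : J e2 = e2) (hJ3 : J e3 = - e3)
  (nabla : {bilinear V -> V -> V}) (hnabla : levi_civita br g nabla)
  (Ric : 'End(V))
  (hRic : operator_of_form g
     (symmetrized (ricci br g e1 e2 e3 (canonical_connection nabla J))) Ric)
  (c : R) :
  (algebraic_ricci_soliton br Ric c <-> [/\ alpha = 0, beta = eta & c = 0]) /\
  ([/\ alpha = 0, beta = eta & c = 0] ->
     forall D : 'End(V), soliton_with br Ric c D -> D = 0).
Proof.
have [_ hs [g11 g22 g33] [g12 g13 g23]] := he.
have brN := lie_bracketN hbr; have [br_alt _] := hbr.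
have gE := (g11, g22, g33, (g12, g13, g23), (hs e2 e1, hs e3 e1, hs e3 e2)).
have brE := (h12, h13, h23, (br_alt e1, br_alt e2, br_alt e3),
  (brN e1 e2, brN e1 e3, brN e2 e3)).
have lE := (linearDl, linearNl, linear0l, linearZl_LR).
pose w X := g (nabla X e1) e2.
have w1 : w e1 = 0.
  have := koszul_formula hs hnabla e1 e1 e2.
  by rewrite !brE !lE /= !gE /w; lra.
have w2 : w e2 = 1.
  have := koszul_formula hs hnabla e2 e1 e2.
  by rewrite !brE !lE /= !gE /w; lra.
have w3 : w e3 = eta + alpha / 2.
  have := koszul_formula hs hnabla e3 e1 e2.
  by rewrite !brE !lE /= !gE /w; lra.
pose p := (2 * eta - beta) * (eta + alpha / 2) - 1.
pose q := (eta + alpha / 2 - beta) / 2.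
have wE X : w X = g X e2 - g X e3 * (eta + alpha / 2).
  rewrite /w [in LHS](basis_expand he X) !lE -!/(w _) w1 w2 w3.
  by rewrite mulr0 add0r mulr1.
pose rho := ricci br g e1 e2 e3 (canonical_connection nabla J).
have rho1 X : rho X e1 = w (br X e2) by exact: ricci_e1.
have rho2 X : rho X e2 = - w (br X e1) by exact: ricci_e2.
have rho3 X : rho X e3 = 0 by exact: ricci_e3.
have ricE X Y : g (Ric X) Y = 2^-1 * (rho X Y + rho Y X).
  by rewrite -hRic.
have Ric1 : Ric e1 = p *: e1.
  rewrite (basis_expand he (Ric e1)) !ricE.
  rewrite !rho1 !rho2 !rho3 !wE !brE !lE /= !gE.
  (* Zero components are inserted so that both sides have the shape of [basis_expand] and can be
     compared coefficient by coefficient. *)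
  rewrite -[RHS]addr0 -[in RHS](scale0r e2) -[RHS]subr0 -(scale0r e3) /p.
  by congr (_ *: _ + _ *: _ - _ *: _); field.
(* The off-diagonal entries of [Ric] have opposite signs because it is self-adjoint for g and e3 is
   timelike. *)
have Ric2 : Ric e2 = p *: e2 - q *: e3.
  rewrite (basis_expand he (Ric e2)) !ricE.
  rewrite !rho1 !rho2 !rho3 !wE !brE !lE /= !gE.
  rewrite -[p *: e2]add0r -[in RHS](scale0r e1) /p /q.
  by congr (_ *: _ + _ *: _ - _ *: _); field.
have Ric3 : Ric e3 = q *: e2.
  rewrite (basis_expand he (Ric e3)) !ricE.
  rewrite !rho1 !rho2 !rho3 !wE !brE !lE /= !gE.
  rewrite /q -[RHS]add0r -(scale0r e1) -[RHS]subr0 -(scale0r e3).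
  by congr (_ *: _ + _ *: _ - _ *: _); field.
(* This settles both the converse, with witness D = 0, and the final claim: c = 0 forces D =
   [Ric]. *)
have Ric0 : [/\ alpha = 0, beta = eta & c = 0] -> Ric = 0.
  case=> a0 b0 _.
  have p0 : p = 0 by rewrite /p a0 b0; case: heta => ->; field.
  have q0 : q = 0 by rewrite /q a0 b0; field.
  apply/lfunP => X; rewrite (basis_expand he X) linearB linearD !linearZ /=.
  by rewrite Ric1 Ric2 Ric3 p0 q0 !(scale0r, oppr0, scaler0, addr0) lfunE.
split; last first.
  move=> h D [_]; rewrite Ric0 //; case: h => _ _ ->.
  by rewrite scale0r add0r.
split=> [[D [hD hDE]] | h]; last first.
  exists 0; split=> [X Y|].
    by rewrite !lfunE /= linear0l linear0r addr0.
  by rewrite Ric0 //; case: h => _ _ ->; rewrite scale0r addr0.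
have DE X : D X = Ric X - c *: X.
  by rewrite hDE add_lfunE scale_lfunE id_lfunE addrC addKr.
have D_frame x y z : D (x *: e1 + y *: e2 + z *: e3) =
    ((p - c) * x) *: e1 + ((p - c) * y + q * z) *: e2 +
    (- q * y - c * z) *: e3.
  (* Pairing with an arbitrary Z turns the vector identity into a scalar one that [ring] can
     decide. *)
  apply: (metric_nondegenerate he) => Z.
  by rewrite DE !linearD !linearZ /= Ric1 Ric2 Ric3 !lE /=; ring.
have br_frame x y z x' y' z' :
    br (x *: e1 + y *: e2 + z *: e3) (x' *: e1 + y' *: e2 + z' *: e3) =
    (alpha * (y * z' - z * y')) *: e1 +
    (- (x * y' - y * x') - beta * (x * z' - z * x')) *: e2 +
    ((2 * eta - beta) * (x * y' - y * x') + (x * z' - z * x')) *: e3.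
  apply: (metric_nondegenerate he) => Z.
  rewrite !lE /= !(linearDr, linearZr_LR) /= !brE.
  by rewrite !lE /=; ring.
have addF x y z x' y' z' :
    (x *: e1 + y *: e2 + z *: e3) + (x' *: e1 + y' *: e2 + z' *: e3) =
    (x + x') *: e1 + (y + y') *: e2 + (z + z') *: e3.
  by rewrite !scalerDl addrACA [in LHS](addrACA (x *: e1)).
(* Basis vectors are written with all three coordinates so that [br_frame] and [D_frame] apply. *)
have := hD (1 *: e1 + 0 *: e2 + 0 *: e3) (0 *: e1 + 1 *: e2 + 0 *: e3).
rewrite br_frame !D_frame !br_frame addF => /(frame_inj he)[_ D12_2 D12_3].
have := hD (1 *: e1 + 0 *: e2 + 0 *: e3) (0 *: e1 + 0 *: e2 + 1 *: e3).
rewrite br_frame !D_frame !br_frame addF => /(frame_inj he)[_ D13_2 _].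
have := hD (0 *: e1 + 1 *: e2 + 0 *: e3) (0 *: e1 + 0 *: e2 + 1 *: e3).
rewrite br_frame !D_frame !br_frame addF => /(frame_inj he)[D23_1 _ _].
apply: soliton_system heta _ _ _ _; rewrite -/p -/q; lra.
Qed.
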